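(* Let $(r_i)_{i\ge0}$ and $(k_i)_{i\ge0}$ be sequences of integers such that $r_0\ge0$, $k_i\ge1$, and $r_{i+1}\ge r_i+16k_i+2$ for all $i$, and let $\gamma\colon[0,1]\to\mathbb{R}^2$ be the uniform limit of the associated curves $\gamma_i$ defined in the context. Suppose that $k_i\ge i$ for all $i$ and $\sum_i\frac1{k_i}<\infty$. Then $$\sigma(\gamma)\lesssim\sum_i\frac1{k_i}.$$
   Context: For a curve $\gamma\colon[0,1]\to\mathbb{R}^2$, $$\sigma(\gamma)=\sum_{i=0}^\infty\sum_{j=0}^{2^i-1}\Big(\operatorname{diam}\big\{\gamma(j2^{-i}),\gamma((2j+1)2^{-i-1}),\gamma((j+1)2^{-i})\big\}\Big)^2.$$ $X\lesssim Y$ means $X\le cY$ with $c$ a universal constant. Construction of $\gamma_i$: for $i\ge0$ let $a_i=\frac13(1-4^{-i})$ and $b_i=\frac13(1+2\cdot4^{-i})$. Let $\alpha\colon[0,\frac13)\cup(\frac13,1]\to\mathbb{R}$ be the piecewise-linear function with $\alpha(a_i)=\alpha(b_i)=i$ and $\alpha$ affine on $[a_i,a_{i+1}]$ and $[b_{i+1},b_i]$ for all $i$. Let $\beta\colon[0,\infty)\to\mathbb{R}^2$ be the map such that $\beta|_{[0,4]}$ is a unit-speed parameterization of the boundary of the unit square with $\beta(0)=\beta(4)=(0,0)$, and $\beta(t)=(0,0)$ for $t\ge4$. For an integer $k>0$ let $\theta_k\colon[0,1]\to\mathbb{R}^2$, $\theta_k(t)=\beta(k^{-1}\alpha(t))=\beta(k^{-1}\min\{4k,\alpha(t)\})$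 (so $\theta_k(\frac13)=(0,0)$). Let $\gamma_0$ be the constant curve $0$. Given $\gamma_i$, for $j=0,\dots,2^{r_i}-1$ let $c_{i,j}=j2^{-r_i}$ (also $c_{i,2^{r_i}}=1$) and $m_{i,j}=\frac{c_{i,j}+c_{i,j+1}}2$, and for $t\in[c_{i,j},c_{i,j+1}]$ let $$\gamma_{i+1}(t)=\begin{cases}\gamma_i(c_{i,j})+2^{-\frac{r_i}2}\theta_{k_i}\big((t-c_{i,j})2^{r_i+1}\big)&t\in[c_{i,j},m_{i,j}],\\ \gamma_i\big(c_{i,j}+2(t-m_{i,j})\big)&t\in[m_{i,j},c_{i,j+1}].\end{cases}$$ The curves $\gamma_i$ converge uniformly to a curve $\gamma$. *)

(* Defs.v *)
From HB Require Import structures.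
From mathcomp Require Import all_boot all_order all_algebra.
From mathcomp Require Import all_classical all_reals all_analysis.

Set Implicit Arguments.
Unset Strict Implicit.
Unset Printing Implicit Defensive.

Import Order.TTheory GRing.Theory Num.Theory.
Import numFieldNormedType.Exports.

Local Open Scope classical_set_scope.
Local Open Scope ring_scope.

(* The plane is 'rV[R]_2.  The norm provided by the library on matrices is the
   sup norm: it is used below only through the topology and the uniform
   structure; distances and lengths are Euclidean. *)
Definition enorm (R : realType) (x : 'rV[R]_2) : R :=
  Num.sqrt (\sum_(i < 2) x 0 i ^+ 2).

Definition diam (R : realType) (A : set 'rV[R]_2) : R :=
  sup [set enorm (x - y) | x in A & y in A].

(* As elsewhere below, a curve on [0, 1] is a function on R whose values
   outside [0, 1] are irrelevant. *)
Definition sigma (R : realType) (gamma : R -> 'rV[R]_2) : \bar R :=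
  (\sum_(0 <= i <oo) \sum_(0 <= j < 2 ^ i)
     (diam [set gamma (j%:R * 2 ^- i);
                gamma ((2 * j + 1)%:R * 2 ^- i.+1);
                gamma (j.+1%:R * 2 ^- i)] ^+ 2)%:E)%E.

Definition polygon_length (R : realType) (f : R -> 'rV[R]_2) (a : R)
    (s : seq R) : R :=
  \sum_(0 <= n < size s)
    enorm (f (nth a (a :: s) n.+1) - f (nth a (a :: s) n)).

Definition arc_length (R : realType) (f : R -> 'rV[R]_2) (a b : R) : \bar R :=
  ereal_sup [set (polygon_length f a s)%:E | s in itv_partition a b].

Definition unit_square (R : realType) : set 'rV[R]_2 :=
  [set x | forall i, 0 <= x 0 i <= 1].

(* The conditions determine beta on [0, +oo[ up to the orientation of the
   square, which is left free. *)
Record square_loop (R : realType) (beta : R -> 'rV[R]_2) : Prop := SquareLoop {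
  square_loop_unit_speed : forall s t : R, 0 <= s -> s <= t -> t <= 4 ->
    arc_length beta s t = (t - s)%:E ;
  square_loop_image :
    beta @` `[0, 4] = closure (unit_square (R := R)) `\` (unit_square (R := R))° ;
  square_loop0 : beta 0 = 0 ;
  square_loop_ge4 : forall t : R, 4 <= t -> beta t = 0 }.

Definition a_ (R : realType) (i : nat) : R := 3^-1 * (1 - 4 ^- i).
Definition b_ (R : realType) (i : nat) : R := 3^-1 * (1 + 2 * 4 ^- i).

Definition affine_on (R : realType) (A : set R) (f : R -> R) : Prop :=
  exists p q : R, forall t, A t -> f t = p * t + q.

(* The intervals cover [0, 1] minus the point 1/3; alpha (1/3) is irrelevant. *)
Record is_alpha (R : realType) (alpha : R -> R) : Prop := IsAlpha {
  is_alpha_a : forall i, alpha (a_ R i) = i%:R ;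
  is_alpha_b : forall i, alpha (b_ R i) = i%:R ;
  is_alpha_left : forall i, affine_on `[a_ R i, a_ R i.+1] alpha ;
  is_alpha_right : forall i, affine_on `[b_ R i.+1, b_ R i] alpha }.

Definition theta (R : realType) (beta : R -> 'rV[R]_2) (alpha : R -> R)
    (k : nat) (t : R) : 'rV[R]_2 :=
  if t == 3^-1 then 0 else beta (k%:R^-1 * alpha t).

(* c_ r_i j and m_ r_i j are the points c_{i,j} and m_{i,j}. *)
Definition c_ (R : realType) (r j : nat) : R := j%:R * 2 ^- r.
Definition m_ (R : realType) (r j : nat) : R := (c_ R r j + c_ R r j.+1) / 2.

Record is_construction (R : realType) (beta : R -> 'rV[R]_2) (alpha : R -> R)
    (r k : nat -> nat) (g : nat -> R -> 'rV[R]_2) : Prop := IsConstruction {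
  is_construction0 : forall t : R, t \in `[0, 1] -> g 0%N t = 0 ;
  is_construction_left : forall i j (t : R), (j < 2 ^ r i)%N ->
    t \in `[c_ R (r i) j, m_ R (r i) j] ->
    g i.+1 t = g i (c_ R (r i) j) +
      2 `^ (- ((r i)%:R / 2)) *:
        theta beta alpha (k i) ((t - c_ R (r i) j) * 2 ^+ (r i).+1) ;
  is_construction_right : forall i j (t : R), (j < 2 ^ r i)%N ->
    t \in `[m_ R (r i) j, c_ R (r i) j.+1] ->
    g i.+1 t = g i (c_ R (r i) j + 2 * (t - m_ R (r i) j)) }.

(* Main.v *)
Require Import Defs.
From HB Require Import structures.
From mathcomp Require Import all_boot all_order all_algebra.
From mathcomp Require Import all_classical all_reals all_analysis.
From mathcomp Require Import ring lra zify.

Set Implicit Arguments.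
Unset Strict Implicit.
Unset Printing Implicit Defensive.

Import Order.TTheory GRing.Theory Num.Theory.
Import numFieldNormedType.Exports.

Local Open Scope classical_set_scope.
Local Open Scope ring_scope.

(** Write [energy n f] for the level-[n] term of sigma, that is, the sum of the
    squared diameters over the dyadic intervals of length 2^-n.  It is local:
    the level-(p + q) energy of a curve is the sum of the level-q energies of
    its restrictions to the dyadic intervals of level p, each rescaled to
    [0, 1] ([energyD]).

    On each interval of level r_i the curve gamma_{i+1} consists of a copy of
    theta_{k_i} shrunk by 2^(-r_i/2), followed by gamma_i run twice as fast.
    There are 2^(r_i) such intervals and squaring the factor gives 2^-r_i, so
    the copies add up to exactly one theta:
      energy (r_i + 1 + q) gamma_{i+1}
        = energy q theta_{k_i} + energy (r_i + q) gamma_i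
    ([construction_energy_tail]).  Moreover gamma and gamma_i agree at the
    dyadic points of level r_i, hence have the same energy at the levels below
    r_i ([limit_energy]).

    The curve theta_k is studied through its self-similarity.  Its restriction
    to [a_s, b_s] splits into the restriction to [a_{s+1}, b_{s+1}] and two
    pieces on which alpha is affine and theta_k moves by at most 1/k, because
    beta is 1-Lipschitz.  Such a piece has level-q energy at most 2^-q / k^2, so
    each of the 4k steps s contributes O(1/k^2) to the sum over all levels, and
    this sum is O(1/k) ([theta_energy_sum]).  Unfolding the same recursion at a
    single level bounds energy q theta_k by O(4^(4k) 2^-q / k^2) for q >= 8k,
    and 4^(4k) = 2^(8k) is beaten by the gap 16k between consecutive r_i
    ([theta_energy_tail]).

    Let M_i be such that energy (r_i + m) gamma_i <= M_i 2^-m for all m.  The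
    two estimates give M_{i+1} <= M_i / 4 + 1 / k_i, while the levels from r_i
    to r_{i+1} add at most 3 M_i + 24 / k_i to the energy of gamma.  Hence the
    quantity (energy of gamma below level r_i) + 4 M_i grows by at most
    28 / k_i at each step ([construction_energy_bound]), which proves the
    theorem with the constant 28. *)

(** * The Euclidean norm and the diameter of three points *)

Lemma enormN (R : realType) (x : 'rV[R]_2) : enorm (- x) = enorm x.
Proof.
by congr Num.sqrt; apply: eq_bigr => i _; rewrite mxE sqrrN.
Qed.

Lemma enormB (R : realType) (x y : 'rV[R]_2) : enorm (x - y) = enorm (y - x).
Proof. by rewrite -enormN opprB. Qed.

Lemma enorm0 (R : realType) : enorm (0 : 'rV[R]_2) = 0.
Proof. by rewrite /enorm big1 ?sqrtr0// => i _; rewrite mxE expr0n. Qed.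

Lemma enormZ (R : realType) (a : R) (x : 'rV[R]_2) :
  0 <= a -> enorm (a *: x) = a * enorm x.
Proof.
move=> a0; rewrite -{2}(ger0_norm a0) -sqrtr_sqr /enorm -sqrtrM ?sqr_ge0//.
by rewrite mulr_sumr; congr Num.sqrt; apply: eq_bigr => i _; rewrite mxE exprMn.
Qed.

Lemma enorm_ge0 (R : realType) (x : 'rV[R]_2) : 0 <= enorm x.
Proof. exact: sqrtr_ge0. Qed.

Definition spread (R : realType) (f : R -> 'rV[R]_2) : R :=
  diam [set f 0; f 2^-1; f 1].

Lemma spreadE (R : realType) (f : R -> 'rV[R]_2) :
  spread f = Num.max (enorm (f 2^-1 - f 0))
    (Num.max (enorm (f 1 - f 2^-1)) (enorm (f 1 - f 0))).
Proof.
set d := RHS.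
have le_d x y : [set f 0; f 2^-1; f 1] x -> [set f 0; f 2^-1; f 1] y ->
    enorm (x - y) <= d.
  by rewrite /d => -[[]|] -> [[]|] ->; rewrite ?subrr ?enorm0 ?le_max ?enorm_ge0//
    ?lexx ?orbT// enormB lexx ?orbT.
have ubd : ubound [set enorm (x - y) |
    x in [set f 0; f 2^-1; f 1] & y in [set f 0; f 2^-1; f 1]] d.
  by move=> _ [x fx [y fy <-]]; exact: le_d.
apply/eqP; rewrite eq_le; apply/andP; split.
  by apply: ge_sup => //; exists (enorm (f 0 - f 0)), (f 0);
    [left; left | exists (f 0); first by left; left].
rewrite /d !ge_max; apply/and3P; split; (apply: ub_le_sup; first by exists d).
- by exists (f 2^-1); [left; right | exists (f 0); first by left; left].
- by exists (f 1); [right | exists (f 2^-1); first by left; right].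
- by exists (f 1); [right | exists (f 0); first by left; left].
Qed.

Lemma spread_ge0 (R : realType) (f : R -> 'rV[R]_2) : 0 <= spread f.
Proof. by rewrite spreadE le_max enorm_ge0. Qed.

Lemma spread_le (R : realType) (f : R -> 'rV[R]_2) (d : R) :
  (spread f <= d) = [&& enorm (f 2^-1 - f 0) <= d,
    enorm (f 1 - f 2^-1) <= d & enorm (f 1 - f 0) <= d].
Proof. by rewrite spreadE !ge_max. Qed.

Lemma spread_affine (R : realType) (f h : R -> 'rV[R]_2) (v : 'rV[R]_2) (a : R) :
  0 <= a -> (forall t, 0 <= t <= 1 -> f t = v + a *: h t) ->
  spread f = a * spread h.
Proof.
move=> a0 fh; rewrite !spreadE !maxr_pMr// !fh ?lexx ?ler01//; last first.
  by apply/andP; split; lra.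
by rewrite -!enormZ// !scalerBr !opprD !addrA ![v + _ - v]addrC !addKr.
Qed.

(** * Energies of the dyadic levels *)

(** The restriction to the [j]-th dyadic interval of level [p], reparametrized
    by [0, 1].  Working with curves on [0, 1] only turns every decomposition of
    the dyadic tree into an identity between energies. *)
Definition zoom (R : realType) (p j : nat) (f : R -> 'rV[R]_2) (t : R) :=
  f ((j%:R + t) * 2 ^- p).

Lemma zoom_zoom (R : realType) p i q j (f : R -> 'rV[R]_2) :
  zoom q j (zoom p i f) = zoom (p + q) (i * 2 ^ q + j) f.
Proof.
apply/funext => t; rewrite /zoom; congr f.
rewrite natrD natrM natrX exprD.
by field; rewrite !expf_neq0.
Qed.

Lemma zoom_itv (R : realType) n j (t : R) : (j < 2 ^ n)%N -> 0 <= t <= 1 ->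
  0 <= (j%:R + t) * 2 ^- n <= 1.
Proof.
move=> jn /andP[t0 t1]; rewrite ler_pdivrMr ?exprn_gt0// mul1r.
rewrite mulr_ge0 ?addr_ge0 ?invr_ge0 ?exprn_ge0//=.
by rewrite (le_trans (lerD (lexx _) t1))// natr1 -natrX ler_nat.
Qed.

Definition energy (R : realType) (n : nat) (f : R -> 'rV[R]_2) : R :=
  \sum_(0 <= j < 2 ^ n) spread (zoom n j f) ^+ 2.

Lemma energy_ge0 (R : realType) n (f : R -> 'rV[R]_2) : 0 <= energy n f.
Proof. by apply: sumr_ge0 => j _; exact: sqr_ge0. Qed.

(** Every dyadic interval of level [p + q] lies in exactly one of level [p]. *)
Lemma energyD (R : realType) p q (f : R -> 'rV[R]_2) :
  energy (p + q) f = \sum_(0 <= i < 2 ^ p) energy q (zoom p i f).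
Proof.
rewrite /energy expnD big_nat_mul; apply: eq_bigr => i _.
rewrite -{1}[(i * _)%N]add0n big_addn mulSn addnK.
by apply: eq_bigr => j _; rewrite zoom_zoom [(j + _)%N]addnC.
Qed.

Lemma energy0 (R : realType) (f : R -> 'rV[R]_2) : energy 0 f = spread f ^+ 2.
Proof.
rewrite /energy big_nat1; congr (spread _ ^+ 2); apply/funext => t.
by rewrite /zoom expr0 invr1 mulr1 add0r.
Qed.

Lemma energyS (R : realType) n (f : R -> 'rV[R]_2) :
  energy n.+1 f = energy n (zoom 1 0 f) + energy n (zoom 1 1 f).
Proof. by rewrite -[n.+1]add1n energyD big_nat_recr//= big_nat1. Qed.

(** The midpoints of the intervals of level [n] are points of level [n.+1], so
    no other value of the curve enters. *)
Lemma eq_energy_dyadic (R : realType) n (f h : R -> 'rV[R]_2) :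
  (forall j, (j <= 2 ^ n.+1)%N -> f (j%:R * 2 ^- n.+1) = h (j%:R * 2 ^- n.+1)) ->
  energy n f = energy n h.
Proof.
move=> fh; apply: eq_big_nat => j /andP[_ jn]; congr (_ ^+ 2).
have j2 : (j.*2.+2 <= 2 ^ n.+1)%N by rewrite -doubleS expnS mul2n leq_double.
rewrite /spread /zoom addr0 natr1.
have -> : j%:R * 2 ^- n = j.*2%:R * 2 ^- n.+1 :> R.
  by rewrite -mul2n natrM exprS; field; rewrite expf_neq0.
have -> : (j%:R + 2^-1) * 2 ^- n = j.*2.+1%:R * 2 ^- n.+1 :> R.
  by rewrite -[j.*2.+1%:R]natr1 -mul2n natrM exprS; field; rewrite expf_neq0.
have -> : j.+1%:R * 2 ^- n = j.*2.+2%:R * 2 ^- n.+1 :> R.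
  by rewrite -doubleS -mul2n natrM exprS; field; rewrite expf_neq0.
by rewrite !fh//; do ?[exact: ltnW]; exact/ltnW/ltnW.
Qed.

Lemma dyadic_itv (R : realType) n j : (j <= 2 ^ n)%N ->
  0 <= (j%:R : R) * 2 ^- n <= 1.
Proof.
move=> jn; rewrite mulr_ge0 ?invr_ge0 ?exprn_ge0//=.
by rewrite ler_pdivrMr ?exprn_gt0// mul1r -natrX ler_nat.
Qed.

Lemma eq_energy (R : realType) n (f h : R -> 'rV[R]_2) :
  (forall t, 0 <= t <= 1 -> f t = h t) -> energy n f = energy n h.
Proof. by move=> fh; apply: eq_energy_dyadic => j jn; exact/fh/dyadic_itv. Qed.

Lemma energy_affine (R : realType) n (f h : R -> 'rV[R]_2) (v : 'rV[R]_2) (a : R) :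
  0 <= a -> (forall t, 0 <= t <= 1 -> f t = v + a *: h t) ->
  energy n f = a ^+ 2 * energy n h.
Proof.
move=> a0 fh; rewrite /energy mulr_sumr; apply: eq_big_nat => j /andP[_ jn].
rewrite (@spread_affine _ _ (zoom n j h) v a)// ?exprMn// => t t01.
exact/fh/zoom_itv.
Qed.

(** There are [2 ^ n] intervals, each of squared spread at most
    [(L * 2 ^- n) ^+ 2]. *)
Lemma energy_lip (R : realType) n (f : R -> 'rV[R]_2) (L : R) :
  (forall s t, 0 <= s -> s <= t -> t <= 1 -> enorm (f t - f s) <= L * (t - s)) ->
  energy n f <= L ^+ 2 * 2 ^- n.
Proof.
move=> fL.
have L0 : 0 <= L.
  have := fL 0 1 (lexx 0) ler01 (lexx 1); rewrite subr0 mulr1.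
  exact: le_trans (enorm_ge0 _).
have -> : L ^+ 2 * 2 ^- n = \sum_(0 <= j < 2 ^ n) (L * 2 ^- n) ^+ 2.
  rewrite sumr_const_nat subn0 -[RHS]mulr_natl natrX; field.
  by rewrite expf_neq0.
rewrite /energy !big_mkord; apply: ler_sum => j _.
rewrite ler_pXn2r ?nnegrE ?spread_ge0 ?mulr_ge0 ?invr_ge0 ?exprn_ge0// spread_le.
have pos : 0 <= 2 ^- n :> R by rewrite invr_ge0 exprn_ge0.
have zL s t : 0 <= s -> s <= t -> t <= 1 ->
    enorm (zoom n j f t - zoom n j f s) <= L * 2 ^- n.
  move=> s0 st t1; have t0 := le_trans s0 st; have s1 := le_trans st t1.
  have /andP[u0 u1] := @zoom_itv _ n j _ (ltn_ord j) (introT andP (conj s0 s1)).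
  have /andP[w0 w1] := @zoom_itv _ n j _ (ltn_ord j) (introT andP (conj t0 t1)).
  apply: le_trans (fL _ _ u0 _ w1) _; first by apply: ler_wpM2r => //; lra.
  by rewrite ler_wpM2l// -mulrBl ler_piMl//; lra.
by rewrite !zL//; lra.
Qed.

(** * The square loop and the intervals where alpha is affine *)

Lemma sum_half_pow_le (R : realType) N : \sum_(0 <= q < N) 2 ^- q <= 2 :> R.
Proof.
have -> : \sum_(0 <= q < N) 2 ^- q = 2 - 2 * 2 ^- N :> R.
  elim: N => [|N IH]; first by rewrite big_nil expr0 invr1 mulr1 subrr.
  by rewrite big_nat_recr//= IH exprS; field; rewrite expf_neq0.
by rewrite gerBl mulr_ge0 ?invr_ge0 ?exprn_ge0.
Qed.

(** A chord is no longer than the arc, and beyond time 4 the loop stays at the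
    point [beta 4]. *)
Lemma square_loop_lip (R : realType) (beta : R -> 'rV[R]_2) (s t : R) :
  square_loop beta -> 0 <= s -> s <= t -> enorm (beta t - beta s) <= t - s.
Proof.
move=> hb s0 st.
have lip4 u v : 0 <= u -> u <= v -> v <= 4 -> enorm (beta v - beta u) <= v - u.
  move=> u0; rewrite le_eqVlt => /predU1P[-> _|uv v4].
    by rewrite !subrr enorm0.
  rewrite -lee_fin -(square_loop_unit_speed hb u0 (ltW uv) v4).
  apply: ereal_sup_ubound; exists [:: v].
    by split; rewrite /= ?uv.
  by rewrite /polygon_length/= big_nat1.
have [t4|/ltW t4] := leP t 4; first exact: lip4.
have [s4|/ltW s4] := leP s 4; last first.
  by rewrite !(square_loop_ge4 hb)// subrr enorm0 subr_ge0.
rewrite (square_loop_ge4 hb t4) -(square_loop_ge4 hb (lexx 4)).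
by apply: le_trans (lip4 _ _ s0 s4 (lexx 4)) _; rewrite lerD2r.
Qed.

Lemma affine_on_interp (R : realType) (f : R -> R) (u v t : R) :
  u <= v -> affine_on `[u, v] f -> 0 <= t <= 1 ->
  f (u + t * (v - u)) = f u + t * (f v - f u).
Proof.
move=> uv [p [q fE]] /andP[t0 t1].
have mem x : u <= x <= v -> `[u, v]%classic x by rewrite /= in_itv.
rewrite !fE//; first ring; apply: mem; rewrite ?lexx ?uv//.
rewrite lerDl mulr_ge0 ?subr_ge0//=.
by rewrite -lerBrDl ler_piMl// subr_ge0.
Qed.

Lemma a_lt (R : realType) i : a_ R i < 3^-1.
Proof.
have : 0 < 4 ^- i :> R by rewrite invr_gt0 exprn_gt0.
by rewrite /a_; lra.
Qed.

Lemma b_gt (R : realType) i : 3^-1 < b_ R i.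
Proof.
have : 0 < 4 ^- i :> R by rewrite invr_gt0 exprn_gt0.
by rewrite /b_; lra.
Qed.

(** * Energy of theta *)

(** The restriction of theta to [[a_ s, b_ s]], reparametrized by [0, 1]; this
    interval has length [4 ^- s] and contains the singular point 1/3. *)
Definition theta_core (R : realType) (beta : R -> 'rV[R]_2) (alpha : R -> R)
    (k s : nat) (t : R) : 'rV[R]_2 :=
  theta beta alpha k (a_ R s + 4 ^- s * t).

Lemma theta_core0 (R : realType) (beta : R -> 'rV[R]_2) (alpha : R -> R) k :
  theta_core beta alpha k 0 = theta beta alpha k.
Proof.
apply/funext => t; rewrite /theta_core /a_ expr0 invr1 subrr mulr0 add0r.
by rewrite mul1r.
Qed.

(** The first quarter of the core is [[a_ s, a_ s.+1]], where alpha increases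
    from [s] to [s + 1]. *)
Lemma theta_core_left (R : realType) (beta : R -> 'rV[R]_2) (alpha : R -> R) k s t :
  is_alpha alpha -> 0 <= t <= 1 ->
  theta_core beta alpha k s (t / 4) = beta (k%:R^-1 * (s%:R + t)).
Proof.
move=> ha t01.
have pos : 0 < 4 ^- s :> R by rewrite invr_gt0 exprn_gt0.
have step : a_ R s.+1 - a_ R s = 4 ^- s / 4.
  by rewrite /a_ exprS; field; rewrite expf_neq0.
have -> : s%:R + t = alpha (a_ R s + t * (a_ R s.+1 - a_ R s)).
  rewrite (affine_on_interp _ (is_alpha_left ha s) t01) ?(is_alpha_a ha).
    by rewrite -[s.+1%:R]natr1; ring.
  by rewrite -subr_ge0 step divr_ge0// ltW.
have -> : t * (a_ R s.+1 - a_ R s) = 4 ^- s * (t / 4) by rewrite step; ring.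
rewrite /theta_core /theta lt_eqF//; apply: le_lt_trans (a_lt R s.+1).
rewrite -(subrK (a_ R s) (a_ R s.+1)) step addrC lerD2r.
by rewrite ler_pM2l//; case/andP: t01; lra.
Qed.

(** The second half of the core is [[b_ s.+1, b_ s]], where alpha decreases from
    [s + 1] to [s]. *)
Lemma theta_core_right (R : realType) (beta : R -> 'rV[R]_2) (alpha : R -> R) k s t :
  is_alpha alpha -> 0 <= t <= 1 ->
  theta_core beta alpha k s ((1 + t) / 2) = beta (k%:R^-1 * (s%:R + (1 - t))).
Proof.
move=> ha t01.
have pos : 0 < 4 ^- s :> R by rewrite invr_gt0 exprn_gt0.
have step : b_ R s - b_ R s.+1 = 4 ^- s / 2.
  by rewrite /b_ exprS; field; rewrite expf_neq0.
have -> : s%:R + (1 - t) = alpha (b_ R s.+1 + t * (b_ R s - b_ R s.+1)).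
  rewrite (affine_on_interp _ (is_alpha_right ha s) t01) ?(is_alpha_b ha).
    by rewrite -[s.+1%:R]natr1; ring.
  by rewrite -subr_ge0 step divr_ge0// ltW.
rewrite /theta_core /theta.
have -> : a_ R s + 4 ^- s * ((1 + t) / 2) =
    b_ R s.+1 + t * (b_ R s - b_ R s.+1).
  by rewrite step /a_ /b_ exprS; field; rewrite expf_neq0.
rewrite gt_eqF//; apply: lt_le_trans (b_gt R s.+1) _.
by rewrite lerDl step; case/andP: t01 => t0 _; rewrite mulr_ge0// divr_ge0// ltW.
Qed.

(** Self-similarity: the second quarter of a core is the next core. *)
Lemma zoom_theta_core (R : realType) (beta : R -> 'rV[R]_2) (alpha : R -> R) k s :
  zoom 2 1 (theta_core beta alpha k s) = theta_core beta alpha k s.+1.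
Proof.
apply/funext => t; rewrite /zoom /theta_core /a_ [4 ^+ s.+1]exprS; congr theta.
by field; rewrite expf_neq0.
Qed.

(** One step of the self-similarity.  From level 2 on, the first quarter and the
    second half of the core carry curves of Lipschitz constant [L] and the
    second quarter carries the next core; the levels 0 and 1, which see the
    singular point, only involve chords between the values of beta at [s / k]
    and [(s + 1) / k] and the Lipschitz half.  The constant [L] is left free
    because it is [1 / k] as long as the loop is running and 0 afterwards. *)
Lemma theta_core_energy_rec (R : realType) (beta : R -> 'rV[R]_2)
    (alpha : R -> R) (k s : nat) (L : R) :
  is_alpha alpha ->
  (forall u v, s%:R <= u -> u <= v -> v <= s%:R + 1 ->
     enorm (beta (k%:R^-1 * v) - beta (k%:R^-1 * u)) <= L * (v - u)) ->
  [/\ energy 0 (theta_core beta alpha k s) <= L ^+ 2,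
      energy 1 (theta_core beta alpha k s) <= 2 * L ^+ 2 &
      forall q, energy q.+2 (theta_core beta alpha k s) <=
        3 / 2 * L ^+ 2 * 2 ^- q + energy q (theta_core beta alpha k s.+1)].
Proof.
move=> ha bL.
have L0 : 0 <= L.
  have := bL s%:R (s%:R + 1) (lexx _); rewrite lerDl ler01 => /(_ isT (lexx _)).
  by rewrite addrAC subrr add0r mulr1; exact/le_trans/enorm_ge0.
have up q : energy q (fun t => beta (k%:R^-1 * (s%:R + t))) <= L ^+ 2 * 2 ^- q.
  apply: energy_lip => u v u0 uv v1.
  by apply: le_trans (bL _ _ _ _ _) _; rewrite ?ler_wpM2l//; lra.
have down q : energy q (zoom 1 1 (theta_core beta alpha k s)) <= L ^+ 2 * 2 ^- q.
  rewrite (@eq_energy _ _ _ (fun t => beta (k%:R^-1 * (s%:R + (1 - t))))).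
    apply: energy_lip => u v u0 uv v1; rewrite enormB.
    by apply: le_trans (bL _ _ _ _ _) _; rewrite ?ler_wpM2l//; lra.
  by move=> t; exact: theta_core_right.
have c0 : theta_core beta alpha k s 0 = beta (k%:R^-1 * s%:R).
  by rewrite -[0](mul0r 4^-1) theta_core_left ?lexx ?ler01// addr0.
have c4 : theta_core beta alpha k s 4^-1 = beta (k%:R^-1 * (s%:R + 1)).
  by rewrite -[4^-1]mul1r theta_core_left ?lexx ?ler01.
have c2 : theta_core beta alpha k s 2^-1 = beta (k%:R^-1 * (s%:R + 1)).
  by rewrite -[2^-1]mul1r -{1}[1]addr0 theta_core_right ?lexx ?ler01// subr0.
have c1 : theta_core beta alpha k s 1 = beta (k%:R^-1 * s%:R).
  rewrite -[X in theta_core _ _ _ _ X](@divff _ 2)// theta_core_right ?lexx ?ler01//.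
  by rewrite subrr addr0.
have bs : enorm (beta (k%:R^-1 * (s%:R + 1)) - beta (k%:R^-1 * s%:R)) <= L.
  apply: le_trans (bL _ _ _ _ _) _; rewrite ?lexx ?lerDl//.
  by rewrite addrAC subrr add0r mulr1.
have half : energy 0 (zoom 1 0 (theta_core beta alpha k s)) <= L ^+ 2.
  rewrite energy0 ler_pXn2r ?nnegrE ?spread_ge0// spread_le /zoom.
  rewrite !add0r mul0r mul1r (_ : 2^-1 * 2^-1 = 4^-1); last by field.
  by rewrite c0 c4 c2 subrr enorm0 L0 bs.
split.
- rewrite energy0 ler_pXn2r ?nnegrE ?spread_ge0// spread_le.
  by rewrite c0 c1 c2 subrr enorm0 L0 bs enormB bs.
- rewrite energyS; have := down 0%N; rewrite expr0 invr1 mulr1; lra.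
- move=> q; rewrite energyS [energy q.+1 (zoom 1 0 _)]energyS !zoom_zoom /=.
  rewrite !(mul0n, add0n, addn0) zoom_theta_core.
  have -> : energy q (zoom 2 0 (theta_core beta alpha k s)) =
      energy q (fun t => beta (k%:R^-1 * (s%:R + t))).
    apply: eq_energy => t t01; rewrite /zoom add0r -(theta_core_left beta k s ha t01).
    by congr theta_core; rewrite -natrX; lra.
  have -> : 3 / 2 * L ^+ 2 * 2 ^- q = L ^+ 2 * 2 ^- q + L ^+ 2 * 2 ^- q.+1.
    by rewrite [2 ^+ q.+1]exprS; field; rewrite expf_neq0.
  by have := up q; have := down q.+1; lra.
Qed.

(** When alpha exceeds [4 * k] the loop is over, so the recursion runs with
    [L = 0] and gains no energy.  It goes through infinitely many cores but
    lowers the level by 2 each time, so the induction is on the level. *)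
Lemma theta_core_vanish (R : realType) (beta : R -> 'rV[R]_2)
    (alpha : R -> R) (k s n : nat) :
  square_loop beta -> is_alpha alpha -> (1 <= k)%N -> (4 * k <= s)%N ->
  energy n (theta_core beta alpha k s) = 0.
Proof.
move=> hb ha k1 ks.
have {}ks s' : (s <= s')%N -> forall u v, s'%:R <= u -> u <= v -> v <= s'%:R + 1 ->
    enorm (beta (k%:R^-1 * v) - beta (k%:R^-1 * u)) <= 0 * (v - u).
  move=> ss u v su uv _; have k0 : 0 < k%:R :> R by rewrite ltr0n.
  have ge4 (w : R) : s'%:R <= w -> 4 <= k%:R^-1 * w.
    move=> sw; rewrite ler_pdivlMl// mulrC -natrM.
    by apply: le_trans sw; rewrite ler_nat (leq_trans ks).
  rewrite !(square_loop_ge4 hb) ?subrr ?enorm0 ?mul0r//; apply: ge4 => //.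
  exact: le_trans uv.
apply/eqP; rewrite eq_le energy_ge0 andbT.
have [m] := ubnP n; elim: m n s ks => [//|m IH] n s ks nm.
have [e0 e1 e2] := theta_core_energy_rec ha (ks s (leqnn _)).
rewrite expr0n/= ?mulr0 in e0 e1 e2.
case: n nm => [//|[//|n]] nm.
apply: le_trans (e2 n) _; rewrite mul0r add0r.
apply: (IH n s.+1); first by move=> s' ss; apply: ks; exact: ltnW.
by rewrite -ltnS; exact: ltnW.
Qed.

Lemma rescaled_loop_lip (R : realType) (beta : R -> 'rV[R]_2) (k s : nat) :
  square_loop beta ->
  forall u v : R, s%:R <= u -> u <= v -> v <= s%:R + 1 ->
     enorm (beta (k%:R^-1 * v) - beta (k%:R^-1 * u)) <= k%:R^-1 * (v - u).
Proof.
move=> hb u v su uv _; rewrite mulrBr.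
have k0 : 0 <= k%:R^-1 :> R by rewrite invr_ge0.
by apply: square_loop_lip => //; rewrite ?ler_wpM2l// mulr_ge0// (le_trans _ su).
Qed.

(** With [d] steps of the loop left, each step costs [L ^+ 2] at level 0, at most
    [2 * L ^+ 2] at level 1 and at most [3 * L ^+ 2] at all higher levels
    together, where [L = 1 / k]. *)
Lemma theta_core_sum (R : realType) (beta : R -> 'rV[R]_2)
    (alpha : R -> R) (k d s N : nat) :
  square_loop beta -> is_alpha alpha -> (1 <= k)%N -> (d + s = 4 * k)%N ->
  \sum_(0 <= q < N) energy q (theta_core beta alpha k s) <=
    6 * d%:R * k%:R^-1 ^+ 2.
Proof.
move=> hb ha k1; elim: d s N => [|d IH] s N ds.
  rewrite big1 ?mulr0 ?mul0r// => q _.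
  by apply: theta_core_vanish => //; rewrite -ds.
have [e0 e1 e2] := theta_core_energy_rec ha (rescaled_loop_lip (s := s) k hb).
have {}IH := IH s.+1 N; rewrite addnS -addSn in IH; have {IH} := IH ds.
set l := k%:R^-1 ^+ 2 in e0 e1 e2 * => IH.
have l0 : 0 <= l by exact: sqr_ge0.
apply: (@le_trans _ _
    (\sum_(0 <= q < N.+2) energy q (theta_core beta alpha k s))).
  (* Two more levels are added so that splitting off the levels 0 and 1 leaves
     the same number of terms for the next core. *)
  by rewrite !big_nat_recr//= -!addrA lerDl addr_ge0 ?energy_ge0.
rewrite !big_nat_recl//=.
have geo : \sum_(0 <= q < N) 3 / 2 * l * 2 ^- q <= 3 * l.
  rewrite -mulr_sumr; apply: le_trans (ler_wpM2l _ (sum_half_pow_le R N)) _; lra.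
have : \sum_(0 <= q < N) energy q.+2 (theta_core beta alpha k s) <=
    \sum_(0 <= q < N) 3 / 2 * l * 2 ^- q +
    \sum_(0 <= q < N) energy q (theta_core beta alpha k s.+1).
  by rewrite -big_split/=; apply: ler_sum => q _; exact: e2.
rewrite -[d.+1%:R]natr1 mulrDr mulr1 mulrDl; lra.
Qed.

(** At a fixed level each step of the recursion lowers the level by 2, which
    multiplies [2 ^- q] by 4; the coefficient [B_d = 2 * (4 ^+ d - 1)] is the
    solution of [B_d.+1 = 4 * B_d + 6] with [B_0 = 0]. *)
Lemma theta_core_tail (R : realType) (beta : R -> 'rV[R]_2)
    (alpha : R -> R) (k d s q : nat) :
  square_loop beta -> is_alpha alpha -> (1 <= k)%N -> (d + s = 4 * k)%N ->
  (2 * d <= q)%N ->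
  energy q (theta_core beta alpha k s) <=
    2 * (4 ^+ d - 1) * 2 ^- q * k%:R^-1 ^+ 2.
Proof.
move=> hb ha k1; elim: d s q => [|d IH] s q ds.
  rewrite expr0 subrr mulr0 !mul0r theta_core_vanish// -ds.
  by rewrite leqnn.
rewrite mulnS; case: q => [|[|q]]//; rewrite addSn addSn add0n !ltnS => dq.
have [_ _ e2] := theta_core_energy_rec ha (rescaled_loop_lip (s := s) k hb).
have {}IH := IH s.+1 q; rewrite addnS -addSn in IH.
apply: le_trans (e2 q) _; apply: le_trans (lerD (lexx _) (IH ds dq)) _.
rewrite le_eqVlt; apply/orP; left; apply/eqP.
rewrite !exprS; field.
by rewrite pnatr_eq0 -lt0n k1 expf_neq0.
Qed.

Lemma theta_energy_sum (R : realType) (beta : R -> 'rV[R]_2)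
    (alpha : R -> R) (k N : nat) :
  square_loop beta -> is_alpha alpha -> (1 <= k)%N ->
  \sum_(0 <= q < N) energy q (theta beta alpha k) <= 24 * k%:R^-1.
Proof.
move=> hb ha k1.
have := @theta_core_sum _ beta alpha k _ 0 N hb ha k1 (addn0 _).
rewrite theta_core0 => /le_trans; apply.
rewrite le_eqVlt; apply/orP; left; apply/eqP; rewrite natrM; field.
by rewrite pnatr_eq0 -lt0n.
Qed.

(** The factor [4 ^+ (4 * k) = 2 ^+ (8 * k)] of the tail bound is absorbed by
    [2 ^- q]. *)
Lemma theta_energy_tail (R : realType) (beta : R -> 'rV[R]_2)
    (alpha : R -> R) (k q m : nat) :
  square_loop beta -> is_alpha alpha -> (1 <= k)%N ->
  (16 * k + 1 + m <= q)%N ->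
  energy q (theta beta alpha k) <= k%:R^-1 * 2 ^- m.
Proof.
move=> hb ha k1 kq.
have dq : (2 * (4 * k) <= q)%N.
  by apply: leq_trans kq; rewrite mulnA -addnA; apply: leq_trans (leq_addr _ _);
    rewrite leq_mul2r orbT.
have := theta_core_tail hb ha k1 (addn0 _) dq.
rewrite theta_core0 => /le_trans; apply.
have kr1 : k%:R^-1 ^+ 2 <= k%:R^-1 :> R.
  by rewrite expr2 ler_piMl ?invr_ge0// invf_le1 ?ltr0n// ler1n.
rewrite mulrC; apply: ler_pM => //; rewrite ?sqr_ge0//.
  by rewrite !mulr_ge0 ?invr_ge0 ?exprn_ge0// subr_ge0 exprn_ege1// ler1n.
rewrite ler_pdivrMr ?exprn_gt0//.
apply: (@le_trans _ _ (2 * 4 ^+ (4 * k))); first by rewrite ler_wpM2l// gerBl.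
rewrite ler_pdivlMl ?exprn_gt0// (_ : 4 = 2 ^+ 2); last by rewrite -natrX.
rewrite -exprM -exprS -exprD; apply: ler_weXn2l; first by rewrite ler1n.
apply: leq_trans kq; rewrite mulnA addnS addn1 addSn ltnS addnC leq_add2r.
by rewrite leq_mul2r orbT.
Qed.


(** * The curves of the construction *)

(** In terms of dyadic intervals, [[c_ r j, m_ r j]] and [[m_ r j, c_ r j.+1]]
    are the intervals of level [r.+1] and indices [2 * j] and [2 * j + 1]. *)
Lemma construction_left (R : realType) (beta : R -> 'rV[R]_2) (alpha : R -> R)
    (r k : nat -> nat) (g : nat -> R -> 'rV[R]_2) i j (t : R) :
  is_construction beta alpha r k g -> (j < 2 ^ r i)%N -> 0 <= t <= 1 ->
  zoom (r i).+1 j.*2 (g i.+1) t = g i (j%:R * 2 ^- r i) +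
    2 `^ (- ((r i)%:R / 2)) *: theta beta alpha (k i) t.
Proof.
move=> hg jr /andP[t0 t1]; rewrite /zoom.
have pos : 0 < 2 ^- r i :> R by rewrite invr_gt0 exprn_gt0.
have tE : (j.*2%:R + t) * 2 ^- (r i).+1 = c_ R (r i) j + t * 2 ^- r i / 2.
  by rewrite /c_ -mul2n natrM exprS; field; rewrite expf_neq0.
have mE : m_ R (r i) j = c_ R (r i) j + 2 ^- r i / 2.
  by rewrite /m_ /c_ -[j.+1%:R]natr1; field; rewrite expf_neq0.
rewrite (is_construction_left hg jr) tE.
  congr (_ + _ *: theta _ _ _ _); rewrite exprS; field.
  by rewrite expf_neq0.
rewrite in_itv/= mE lerDl lerD2l !mulr_ge0 ?invr_ge0 ?(ltW pos)//=.
by rewrite ler_pM2r ?invr_gt0// ler_piMl// ltW.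
Qed.

Lemma construction_right (R : realType) (beta : R -> 'rV[R]_2) (alpha : R -> R)
    (r k : nat -> nat) (g : nat -> R -> 'rV[R]_2) i j (t : R) :
  is_construction beta alpha r k g -> (j < 2 ^ r i)%N -> 0 <= t <= 1 ->
  zoom (r i).+1 j.*2.+1 (g i.+1) t = zoom (r i) j (g i) t.
Proof.
move=> hg jr /andP[t0 t1]; rewrite /zoom.
have pos : 0 < 2 ^- r i :> R by rewrite invr_gt0 exprn_gt0.
have mE : m_ R (r i) j = c_ R (r i) j + 2 ^- r i / 2.
  by rewrite /m_ /c_ -[j.+1%:R]natr1; field; rewrite expf_neq0.
have tE : (j.*2.+1%:R + t) * 2 ^- (r i).+1 = m_ R (r i) j + t * 2 ^- r i / 2.
  rewrite mE /c_ -[j.*2.+1%:R]natr1 -mul2n natrM exprS; field.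
  by rewrite expf_neq0.
rewrite (is_construction_right hg jr) tE.
  by congr (g i _); rewrite /c_; field; rewrite expf_neq0.
rewrite in_itv/= lerDl !mulr_ge0 ?invr_ge0 ?(ltW pos)//= mE.
have -> : c_ R (r i) j.+1 = c_ R (r i) j + 2 ^- r i / 2 + 2 ^- r i / 2.
  by rewrite /c_ -[j.+1%:R]natr1; field; rewrite expf_neq0.
by rewrite lerD2l ler_pM2r ?invr_gt0// ler_piMl// ltW.
Qed.

Lemma theta0 (R : realType) (beta : R -> 'rV[R]_2) (alpha : R -> R) k :
  square_loop beta -> is_alpha alpha -> theta beta alpha k 0 = 0.
Proof.
move=> hb ha; rewrite -theta_core0 -[X in theta_core _ _ _ _ X](mul0r 4^-1).
by rewrite theta_core_left ?lexx ?ler01// addr0 mulr0 (square_loop0 hb).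
Qed.

(** theta starts at the origin, so a left half begins at the old value; the last
    node [j = 2 ^ r i] is the start of no left half, so every [j > 0] is treated
    as the end of a right half. *)
Lemma construction_node (R : realType) (beta : R -> 'rV[R]_2) (alpha : R -> R)
    (r k : nat -> nat) (g : nat -> R -> 'rV[R]_2) i j :
  square_loop beta -> is_alpha alpha -> is_construction beta alpha r k g ->
  (j <= 2 ^ r i)%N -> g i.+1 (j%:R * 2 ^- r i) = g i (j%:R * 2 ^- r i).
Proof.
move=> hb ha hg; case: j => [_|j jr].
  have /= := @construction_left _ beta alpha r k g i 0 0 hg.
  rewrite expn_gt0 /= lexx ler01 => /(_ isT isT).
  by rewrite /zoom theta0// scaler0 addr0 addr0 double0 !mul0r.
have := @construction_right _ beta alpha r k g i j 1 hg jr.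
rewrite lexx ler01 => /(_ isT); rewrite /zoom !natr1 => <-; congr (g _ _).
by rewrite -doubleS -mul2n natrM exprS; field; rewrite expf_neq0.
Qed.

Lemma dyadic_refine (R : realType) n p j : (n <= p)%N ->
  j%:R * 2 ^- n = (j * 2 ^ (p - n))%:R * 2 ^- p :> R.
Proof.
move=> np; rewrite natrM natrX -{2}(subnK np) exprD; field.
by rewrite !expf_neq0.
Qed.

Lemma construction_stable (R : realType) (beta : R -> 'rV[R]_2) (alpha : R -> R)
    (r k : nat -> nat) (g : nat -> R -> 'rV[R]_2) i l n j :
  square_loop beta -> is_alpha alpha -> is_construction beta alpha r k g ->
  {homo r : i j / (i <= j)%N} ->
  (n <= r i)%N -> (j <= 2 ^ n)%N ->
  g (l + i)%N (j%:R * 2 ^- n) = g i (j%:R * 2 ^- n).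
Proof.
move=> hb ha hg rmono nr jn; elim: l => [//|l <-].
have nl : (n <= r (l + i))%N by apply: (leq_trans nr); rewrite rmono// leq_addl.
rewrite (dyadic_refine R j nl) addSn (construction_node hb ha hg)//.
by rewrite -{2}(subnK nl) expnD mulnC leq_mul2l jn orbT.
Qed.

(** The energy below level [r i] only sees dyadic points of level [r i], where
    the sequence of curves is constant from rank [i] on. *)
Lemma limit_energy (R : realType) (beta : R -> 'rV[R]_2) (alpha : R -> R)
    (r k : nat -> nat) (g : nat -> R -> 'rV[R]_2) (gamma : R -> 'rV[R]_2) i n :
  square_loop beta -> is_alpha alpha -> is_construction beta alpha r k g ->
  {homo r : i j / (i <= j)%N} -> {uniform `[0, 1], g @ \oo --> gamma} ->
  (n < r i)%N -> energy n gamma = energy n (g i).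
Proof.
move=> hb ha hg rmono lim nr; apply: eq_energy_dyadic => j jn.
set x : R := _ * _.
have x01 : `[0, 1]%classic x by rewrite /= in_itv; exact: dyadic_itv.
have gx : g ^~ x @ \oo --> gamma x.
  have : {uniform [set x], g @ \oo --> gamma}.
    by apply: uniform_subset_cvg lim => _ ->.
  by rewrite uniform_set1.
apply: (cvg_unique _ gx) => //.
apply/cvg_ballP => e e0; near=> m.
have im : (i <= m)%N by near: m; exact: nbhs_infty_ge.
rewrite -(subnK im) (construction_stable _ hb ha hg rmono nr jn).
exact: ballxx.
Unshelve. all: by end_near. Qed.

(** The [2 ^ r i] copies of theta are scaled by [2 ^ (- r i / 2)], so their squared
    spreads add up to those of a single theta. *)
Lemma construction_energy_tail (R : realType) (beta : R -> 'rV[R]_2) (alpha : R -> R)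
    (r k : nat -> nat) (g : nat -> R -> 'rV[R]_2) i q :
  is_construction beta alpha r k g ->
  energy ((r i).+1 + q) (g i.+1) =
    energy q (theta beta alpha (k i)) + energy (r i + q) (g i).
Proof.
move=> hg; rewrite addSnnS !energyD.
under eq_big_nat => j /andP[_ jr].
  rewrite energyS !zoom_zoom !addn1 expn1 muln2 addn0.
  rewrite (energy_affine _ _ (fun t => construction_left hg jr)) ?powR_ge0//.
  rewrite (eq_energy q (fun t => construction_right hg jr)).
  over.
rewrite big_split/=; congr (_ + _).
rewrite sumr_const_nat subn0 -[LHS]mulr_natl natrX mulrA.
rewrite -[_ `^ _ ^+ 2]powR_mulrn ?powR_ge0// -powRrM mulNr divfK//.
by rewrite powR_invn// divff ?mul1r// expf_neq0.
Qed.

(** At level [r i] itself the new curve has its midpoint value at the left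
    endpoint, so only one chord of the old curve remains. *)
Lemma construction_energy_node (R : realType) (beta : R -> 'rV[R]_2) (alpha : R -> R)
    (r k : nat -> nat) (g : nat -> R -> 'rV[R]_2) i :
  square_loop beta -> is_alpha alpha -> is_construction beta alpha r k g ->
  energy (r i) (g i.+1) <= energy (r i) (g i).
Proof.
move=> hb ha hg; rewrite /energy !big_mkord; apply: ler_sum => j _.
have jr := ltn_ord j.
rewrite ler_pXn2r ?nnegrE ?spread_ge0//.
have e0 : zoom (r i) j (g i.+1) 0 = zoom (r i) j (g i) 0.
  by rewrite /zoom addr0 (construction_node hb ha hg (ltnW jr)).
have e1 : zoom (r i) j (g i.+1) 1 = zoom (r i) j (g i) 1.
  by rewrite /zoom natr1 (construction_node hb ha hg jr).
have e2 : zoom (r i) j (g i.+1) 2^-1 = zoom (r i) j (g i) 0.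
  rewrite -(construction_right hg jr) ?lexx ?ler01// /zoom; congr (g _ _).
  by rewrite -[j.*2.+1%:R]natr1 -mul2n natrM exprS; field; rewrite expf_neq0.
rewrite spread_le e0 e1 e2 subrr enorm0 spread_ge0/=.
by have := lexx (spread (zoom (r i) j (g i))); rewrite {1}spread_le => /and3P[_ _ ->].
Qed.

(** * Summing the levels *)

Lemma construction0_energy (R : realType) (beta : R -> 'rV[R]_2) (alpha : R -> R)
    (r k : nat -> nat) (g : nat -> R -> 'rV[R]_2) n :
  is_construction beta alpha r k g -> energy n (g 0%N) = 0.
Proof.
move=> hg; rewrite (@energy_affine _ _ _ (g 0%N) 0 0)// ?expr0n ?mul0r// => t t01.
by rewrite (is_construction0 hg) ?in_itv// scale0r addr0.
Qed.

(** The weight 4 in front of [M] makes the left-hand side of the last inequality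
    a potential: passing to [i.+1], the new levels cost [M] at level [r i] and
    [2 * M + 24 / k i] above it, and the new weight is [M + 4 / k i], which adds
    up to the old weight [4 * M] plus [28 / k i]. *)
Lemma construction_energy_bound (R : realType) (beta : R -> 'rV[R]_2)
    (alpha : R -> R) (r k : nat -> nat) (g : nat -> R -> 'rV[R]_2)
    (gamma : R -> 'rV[R]_2) i :
  square_loop beta -> is_alpha alpha -> is_construction beta alpha r k g ->
  {uniform `[0, 1], g @ \oo --> gamma} ->
  (forall i, (1 <= k i)%N) -> (forall i, (r i + 16 * k i + 2 <= r i.+1)%N) ->
  exists M : R, [/\ 0 <= M,
    forall m, energy (r i + m) (g i) <= M * 2 ^- m &
    \sum_(0 <= n < r i) energy n gamma + 4 * M <=
      28 * \sum_(0 <= l < i) (k l)%:R^-1].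
Proof.
move=> hb ha hg lim k1 rk.
have rmono : {homo r : i j / (i <= j)%N}.
  apply: homo_leq => // [? ? ?|l]; first exact: leq_trans.
  by apply: leq_trans (rk l); rewrite -addnA leq_addr.
elim: i => [|i [M [M0 tail head]]].
  exists 0; split=> // [m|]; first by rewrite (construction0_energy _ hg) mul0r.
  rewrite !big_nil !mulr0 addr0 big_nat big1// => n nr.
  by rewrite (limit_energy hb ha hg rmono lim nr) (construction0_energy _ hg).
have kV0 : 0 <= (k i)%:R^-1 :> R by rewrite invr_ge0.
exists (M / 4 + (k i)%:R^-1); split.
- by rewrite addr_ge0// divr_ge0.
(* The gap between [r i] and [r i.+1] is at least [16 * k i + 2]: the [16 * k i]
   absorbs the growth of theta, and it exceeds the 2 levels needed to bring
   [M] down to [M / 4]. *)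
- move=> m; set q := (r i.+1 + m - (r i).+1)%N.
  have qE : (r i.+1 + m = (r i).+1 + q)%N.
    by rewrite /q subnKC//; have := rk i; lia.
  have mq : (16 * k i + 1 + m <= q)%N by have := rk i; lia.
  rewrite qE (construction_energy_tail _ _ hg) mulrDl [leRHS]addrC.
  apply: lerD; first exact: theta_energy_tail.
  apply: le_trans (tail q) _; rewrite -mulrA ler_wpM2l//.
  rewrite (_ : 4 = 2 ^+ 2 :> R); last by rewrite -natrX.
  rewrite -invfM -exprD lef_pV2 ?posrE ?exprn_gt0// ler_weXn2l ?ler1n//.
  by have := k1 i; lia.
- set p := (r i.+1 - (r i).+1)%N.
  have pE : (r i.+1 = p + (r i).+1)%N.
    by rewrite /p subnK//; have := rk i; lia.
  have ri : (r i <= r i.+1)%N by rewrite rmono.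
  rewrite (big_cat_nat (leq0n _) ri)//= (big_nat_recr i)//=.
  have -> : \sum_(r i <= n < r i.+1) energy n gamma =
      energy (r i) (g i.+1) + (\sum_(0 <= q < p) energy q (theta beta alpha (k i)) +
      \sum_(0 <= q < p) energy (r i + q) (g i)).
    rewrite (eq_big_nat _ _ (F2 := fun n => energy n (g i.+1))); last first.
      by move=> n /andP[_ nr]; exact: (limit_energy hb ha hg rmono lim nr).
    rewrite pE big_ltn; last by rewrite addnS ltnS leq_addl.
    congr (_ + _); rewrite -{1}[(r i).+1]add0n big_addn addnK -big_split/=.
    by apply: eq_bigr => q _; rewrite addnC (construction_energy_tail _ _ hg).
  have h1 := theta_energy_sum p hb ha (k1 i).
  have h2 : \sum_(0 <= q < p) energy (r i + q) (g i) <= M * 2.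
    apply: (@le_trans _ _ (\sum_(0 <= q < p) M * 2 ^- q)).
      by apply: ler_sum => q _; exact: tail.
    by rewrite -mulr_sumr ler_wpM2l// sum_half_pow_le.
  have h3 := construction_energy_node i hb ha hg.
  have := tail 0%N; rewrite addn0 expr0 invr1 mulr1.
  by rewrite mulrDr; lra.
Qed.

Lemma sigmaE (R : realType) (gamma : R -> 'rV[R]_2) :
  sigma gamma = (\sum_(0 <= n <oo) (energy n gamma)%:E)%E.
Proof.
congr (limn _); apply/funext => N; apply: eq_bigr => n _.
rewrite /energy -sumEFin; apply: eq_bigr => j _.
rewrite /spread /zoom addr0 natr1.
have -> : (j%:R + 2^-1) * 2 ^- n = (2 * j + 1)%:R * 2 ^- n.+1 :> R.
  by rewrite natrD natrM exprS; field; rewrite expf_neq0.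
by [].
Qed.

Theorem lemmaB5 (R : realType) :
  exists c : R, 0 < c /\
  forall (beta : R -> 'rV[R]_2) (alpha : R -> R) (r k : nat -> nat)
    (g : nat -> R -> 'rV[R]_2) (gamma : R -> 'rV[R]_2),
    square_loop beta ->
    is_alpha alpha ->
    is_construction beta alpha r k g ->
    {uniform `[0, 1], g @ \oo --> gamma} ->
    (forall i, (1 <= k i)%N) ->
    (forall i, (r i + 16 * k i + 2 <= r i.+1)%N) ->
    (forall i, (i <= k i)%N) ->
    (\sum_(0 <= i <oo) ((k i)%:R^-1 : R)%:E < +oo)%E ->
    (sigma gamma <= c%:E * \sum_(0 <= i <oo) ((k i)%:R^-1 : R)%:E)%E.
Proof.
exists 28; split=> // beta alpha r k g gamma hb ha hg lim k1 rk _ _.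
have r_ge N : (N <= r N)%N.
  by elim: N => [//|N IH]; have := rk N; lia.
rewrite sigmaE; apply: lime_le.
  by apply: is_cvg_nneseries => n _ _; rewrite lee_fin energy_ge0.
apply: nearW => N; rewrite sumEFin.
have [M [M0 _ bound]] := construction_energy_bound N hb ha hg lim k1 rk.
apply: (@le_trans _ _ (28 * \sum_(0 <= l < N) (k l)%:R^-1)%:E).
  rewrite lee_fin; apply: le_trans bound.
  rewrite (big_cat_nat (leq0n _) (r_ge N))//= -addrA lerDl addr_ge0 ?mulr_ge0//.
  by apply: sumr_ge0 => n _; exact: energy_ge0.
rewrite EFinM -sumEFin lee_wpmul2l ?lee_fin//.
by apply: nneseries_lim_ge => l _ _; rewrite lee_fin invr_ge0.
Qed.
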